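(* Let $M$ be a smooth connected manifold with a linear connection $\nabla$ (a connection on $TM$) with torsion $T$ and curvature $\mathfrak{R}$. The following two statements are equivalent: (i) for every $1$-form $\theta\in\bigwedge^1(M)$, $dT_\theta=d\Xi_\theta=\mathfrak{R}_\theta+\nabla\theta\wedge T$; (ii) for all $X,Y,Z\in\mathfrak{X}(M)$, $$\sum_{\mathrm{cyclic}\ XYZ}\mathfrak{R}(X,Y)Z=\sum_{\mathrm{cyclic}\ XYZ}(\nabla_XT)(Y,Z)+\sum_{\mathrm{cyclic}\ XYZ}T(T(X,Y),Z).$$
   Context: $\mathfrak{X}(M)$ denotes smooth vector fields on $M$. Torsion and curvature: $T(X,Y)=\nabla_XY-\nabla_YX-[X,Y]$, $\mathfrak{R}(X,Y)Z=\nabla_X\nabla_YZ-\nabla_Y\nabla_XZ-\nabla_{[X,Y]}Z$. Covariant derivatives of tensors are the usual ones: $(\nabla_X\theta)(Y)=X(\theta(Y))-\theta(\nabla_XY)$, $(\nabla_XT)(Y,Z)=\nabla_X(T(Y,Z))-T(\nabla_XY,Z)-T(Y,\nabla_XZ)$. The forms are $T_\theta(X,Y)=\theta(T(X,Y))$, $\Xi_\theta(X,Y)=(\nabla_Y\theta)(X)-(\nabla_X\theta)(Y)$, $\mathfrak{R}_\theta(X,Y,Z)=\sum_{\mathrm{cyclic}\ XYZ}\theta(\mathfrak{R}(X,Y)Z)$, $(\nabla\theta\wedge T)(X,Y,Z)=\sum_{\mathrm{cyclic}\ XYZ}(\nabla_X\theta)(T(Y,Z))$. $\sum_{\mathrm{cyclic}\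 XYZ}$ is the sum over the three cyclic permutations of $(X,Y,Z)$. The exterior derivative of a $2$-form $\beta$ is normalized by $d\beta(X,Y,Z)=\sum_{\mathrm{cyclic}\ XYZ}\big(X(\beta(Y,Z))-\beta([X,Y],Z)\big)$. *)

(* Defs.v *)
From HB Require Import structures.
From mathcomp Require Import all_boot all_order all_algebra.
From mathcomp Require Import ring.
From mathcomp Require Import all_classical all_reals all_analysis.

Set Implicit Arguments.
Unset Strict Implicit.
Unset Printing Implicit Defensive.

Import Order.TTheory GRing.Theory Num.Theory.
Import numFieldNormedType.Exports.

Local Open Scope classical_set_scope.
Local Open Scope ring_scope.

(** Maps of class C^k and C^oo on a subset U (meant to be open) of a normed
    space: all iterated directional derivatives up to order k exist and are
    continuous at the points of U.  In finite dimension this is the usual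
    notion. *)

Section Smoothness.
Context {R : realType} {V W : normedModType R}.
Implicit Types (U : set V) (f g : V -> W).

Fixpoint Ck_on (k : nat) (U : set V) (f : V -> W) : Prop :=
  if k is k'.+1 then
    [/\ forall x, U x -> {for x, continuous f},
        forall v x, U x -> derivable f x v
      & forall v, Ck_on k' U ('D_v f)]
  else forall x, U x -> {for x, continuous f}.

Definition smooth_on (U : set V) (f : V -> W) : Prop :=
  forall k, Ck_on k U f.

Lemma Ck_on_continuous k U f x : Ck_on k U f -> U x -> {for x, continuous f}.
Proof. by case: k => [|k] => [+|[+ _ _]]; apply. Qed.

Lemma Ck_onW k U f : Ck_on k.+1 U f -> Ck_on k U f.
Proof.
elim: k f => [|k IH] f; first by case.
by case=> cf df Df; split=> // v; exact: IH.
Qed.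

Lemma Ck_on_ext k U f g : open U -> (forall x, U x -> f x = g x) ->
  Ck_on k U f -> Ck_on k U g.
Proof.
move=> oU.
have near_eq (h l : V -> W) x : U x -> (forall y, U y -> h y = l y) ->
    {near x, h =1 l}.
  move=> Ux hl; have nU : nbhs x U by exact: open_nbhs_nbhs.
  by apply: filterS nU => y /hl.
have cont (h l : V -> W) x : (forall y, U y -> h y = l y) -> U x ->
    {for x, continuous h} -> {for x, continuous l}.
  move=> hl Ux ch; have hx : h y @[y --> x] --> l x by rewrite -hl.
  by apply: cvg_trans hx; apply: near_eq_cvg; exact: near_eq.
elim: k f g => [|k IH] f g fg /=.
  by move=> cf x Ux; apply: (cont f) (cf _ Ux).
case=> cf df Df; split=> [x Ux|v x Ux|v].
- by apply: (cont f) (cf _ Ux).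
- by apply: near_eq_derivable (df v x Ux); exact: near_eq.
- by apply: IH (Df v) => x Ux; apply: near_eq_derive; exact: near_eq.
Qed.

Lemma Ck_on_cst k U (c : W) : Ck_on k U (cst c).
Proof.
elim: k c => [|k IH] c /=; first by move=> x _; exact: cvg_cst.
split=> [x _|v x _|v]; [exact: cvg_cst|exact: derivable_cst|].
have -> : 'D_v (cst c) = cst 0 :> (V -> W) by apply/funext => x; rewrite derive_cst.
exact: IH.
Qed.

Lemma Ck_onD k U f g : open U ->
  Ck_on k U f -> Ck_on k U g -> Ck_on k U (f + g).
Proof.
move=> oU; elim: k f g => [|k IH] f g.
  by move=> cf cg x Ux; apply: continuousD; [exact: cf|exact: cg].
move=> [cf df Df] [cg dg Dg]; split=> [x Ux|v x Ux|v].
- by apply: continuousD; [exact: cf|exact: cg].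
- by apply: derivableD; [exact: df|exact: dg].
- apply: (Ck_on_ext oU _ (IH _ _ (Df v) (Dg v))) => x Ux.
  by rewrite deriveD //; [exact: df|exact: dg].
Qed.

Lemma Ck_onZ k U (c : R) f : open U -> Ck_on k U f -> Ck_on k U (c *: f).
Proof.
move=> oU; elim: k f => [|k IH] f.
  by move=> cf x Ux; apply: continuousZr; exact: cf.
move=> [cf df Df]; split=> [x Ux|v x Ux|v].
- by apply: continuousZr; exact: cf.
- by apply: derivableZ; exact: df.
- apply: (Ck_on_ext oU _ (IH _ (Df v))) => x Ux.
  by rewrite deriveZ //; exact: df.
Qed.

End Smoothness.

Lemma Ck_onM {R : realType} {V : normedModType R} k (U : set V) (f g : V -> R^o) :
  open U -> Ck_on k U f -> Ck_on k U g -> Ck_on k U (f * g).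
Proof.
move=> oU; elim: k f g => [|k IH] f g.
  by move=> cf cg x Ux; apply: continuousM; [exact: cf|exact: cg].
move=> Hf Hg.
have [cf df Df] := Hf; have [cg dg Dg] := Hg.
split=> [x Ux|v x Ux|v].
- by apply: continuousM; [exact: cf|exact: cg].
- by apply: derivableM; [exact: df|exact: dg].
- have H := Ck_onD oU (IH _ _ (Ck_onW Hf) (Dg v)) (IH _ _ (Ck_onW Hg) (Df v)).
  apply: (Ck_on_ext oU _ H) => x Ux.
  by rewrite deriveM //; [exact: df|exact: dg].
Qed.

(** [chart_dom] is the domain of the chart and [chart_inv] the inverse map; the
    values of [chart_map] off [chart_dom] and of [chart_inv] off [chart_img]
    are irrelevant. *)
Record chart (R : realType) (n : nat) (M : topologicalType) := Chart {
  chart_dom : set M;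
  chart_map : M -> 'rV[R]_n;
  chart_inv : 'rV[R]_n -> M;
  open_chart_dom : open chart_dom;
  open_chart_img : open (chart_map @` chart_dom);
  chart_mapK : forall p, chart_dom p -> chart_inv (chart_map p) = p;
  chart_map_continuous :
    forall p, chart_dom p -> {for p, continuous chart_map};
  chart_inv_continuous :
    forall x, (chart_map @` chart_dom) x -> {for x, continuous chart_inv}
}.

Arguments open_chart_dom {R n M}.
Arguments open_chart_img {R n M}.

Definition chart_img (R : realType) (n : nat) (M : topologicalType)
  (a : chart R n M) : set 'rV[R]_n := chart_map a @` chart_dom a.

Definition smooth_transition (R : realType) (n : nat) (M : topologicalType)
    (a b : chart R n M) : Prop :=
  smooth_on (chart_map a @` (chart_dom a `&` chart_dom b))
            (chart_map b \o chart_inv a).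

(** The atlas is not required to be maximal: an atlas and the maximal one
    containing it have the same smooth functions. *)
Record manifold (R : realType) (n : nat) := Manifold {
  carrier :> topologicalType;
  atlas : set (chart R n carrier);
  manifold_hausdorff : hausdorff_space carrier;
  manifold_second_countable : @second_countable carrier;
  atlas_cover : forall p : carrier, exists2 a, atlas a & chart_dom a p;
  atlas_compatible :
    forall a b, atlas a -> atlas b -> smooth_transition a b
}.

Section SmoothFunctions.
Context (R : realType) (n : nat) (M : manifold R n).

Definition is_smooth (f : M -> R^o) : Prop :=
  forall a, atlas a -> smooth_on (chart_img a) (f \o chart_inv a).

Definition smooth_pred : {pred M -> R^o} := fun f => `[< is_smooth f >].

Record Cinf := MkCinf { Cinf_val :> M -> R^o; _ : Cinf_val \in smooth_pred }.

HB.instance Definition _ := [isSub for Cinf_val].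
HB.instance Definition _ := [Choice of Cinf by <:].

Lemma Cinf_smooth (f : Cinf) : is_smooth f.
Proof. by case: f => f sf; exact/asboolP. Qed.

Lemma smooth_subring_closed : subring_closed smooth_pred.
Proof.
split=> [|f g /asboolP sf /asboolP sg|f g /asboolP sf /asboolP sg];
  apply/asboolP => a Aa k.
- exact: (Ck_on_cst _ _ (1 : R^o)).
- have oI := open_chart_img a; rewrite -[g]opprK opprK -scaleN1r.
  exact: Ck_onD oI (sf a Aa k) (Ck_onZ (-1) oI (sg a Aa k)).
- exact: Ck_onM (open_chart_img a) (sf a Aa k) (sg a Aa k).
Qed.

Lemma smooth_submod_closed : submod_closed smooth_pred.
Proof.
split=> [|c f g /asboolP sf /asboolP sg]; apply/asboolP => a Aa k.
- exact: (Ck_on_cst _ _ (0 : R^o)).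
- have oI := open_chart_img a.
  exact: Ck_onD oI (Ck_onZ c oI (sf a Aa k)) (sg a Aa k).
Qed.

HB.instance Definition _ :=
  GRing.isSubringClosed.Build _ smooth_pred smooth_subring_closed.
HB.instance Definition _ :=
  GRing.isSubmodClosed.Build _ _ smooth_pred smooth_submod_closed.
HB.instance Definition _ :=
  GRing.SubChoice_isSubComPzRing.Build _ _ Cinf smooth_subring_closed.
HB.instance Definition _ := [SubZmodule_isSubLmodule of Cinf by <:].

End SmoothFunctions.

Section TangentSpace.
Context (R : realType) (n : nat) (M : manifold R n).

Definition is_derivation_at (p : M) (v : Cinf M -> R^o) : Prop :=
  [/\ forall f g, v (f + g) = v f + v g,
      forall (c : R) f, v (c *: f) = c * v f
    & forall f g, v (f * g) = f p * v g + g p * v f].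

Definition derivation_pred (p : M) : {pred Cinf M -> R^o} :=
  fun v => `[< is_derivation_at p v >].

(** T_pM as the space of derivations at p of C^oo(M).  These are local, so it is
    the usual n-dimensional tangent space, because the carrier of a manifold is
    Hausdorff and second countable (bump functions). *)
Record tangent (p : M) := MkTangent {
  tangent_val :> Cinf M -> R^o;
  _ : tangent_val \in derivation_pred p
}.

HB.instance Definition _ p := [isSub for @tangent_val p].
HB.instance Definition _ p := [Choice of tangent p by <:].

Lemma tangentP p (v : tangent p) : is_derivation_at p v.
Proof. by case: v => v dv; exact/asboolP. Qed.

Lemma derivation_submod_closed p : submod_closed (derivation_pred p).
Proof.
split=> [|c u v /asboolP[uD uZ uM] /asboolP[vD vZ vM]]; apply/asboolP; split.
- by move=> f g; rewrite /= addr0.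
- by move=> c f; rewrite /= mulr0.
- by move=> f g; rewrite /= !mulr0 addr0.
- by move=> f g; rewrite !fctE uD vD scalerDr addrACA.
- by move=> d f; rewrite !fctE uZ vZ mulrDr /GRing.scale /= mulrCA.
- move=> f g; rewrite !fctE uM vM !mulrDr scalerDr addrACA.
  by rewrite /GRing.scale /= ![c * (_ * _)]mulrCA.
Qed.

HB.instance Definition _ p := GRing.isSubmodClosed.Build _ _
  (derivation_pred p) (derivation_submod_closed p).
HB.instance Definition _ p := [SubChoice_isSubLmodule of tangent p by <:].

Definition smooth_field (X : forall p : M, tangent p) : Prop :=
  forall f : Cinf M, is_smooth (fun p => X p f).

Record vfield := MkVfield {
  vfield_at :> forall p : M, tangent p;
  vfield_smooth : smooth_field vfield_at
}.

HB.instance Definition _ := gen_eqMixin vfield.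
HB.instance Definition _ := gen_choiceMixin vfield.

Definition vact (X : vfield) (f : Cinf M) : Cinf M :=
  MkCinf (asboolT (vfield_smooth X f)).

Lemma Cinf_eq (f g : Cinf M) : (forall p, f p = g p) -> f = g.
Proof. by move=> fg; apply/val_inj/funext. Qed.

Lemma vfield_eq (X Y : vfield) : (forall p f, X p f = Y p f) -> X = Y.
Proof.
case: X Y => [X sX] [Y sY] /= XY.
have {}XY : X = Y.
  by apply: functional_extensionality_dep => p; apply/val_inj/funext => f; exact: XY.
by rewrite XY in sX *; congr MkVfield; exact: Prop_irrelevance.
Qed.

Lemma vfield0_smooth : smooth_field (fun p => 0).
Proof. by move=> f; exact: Cinf_smooth (0 : Cinf M). Qed.
Definition vfield0 := MkVfield vfield0_smooth.

Lemma vfieldN_smooth (X : vfield) : smooth_field (fun p => - X p).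
Proof. by move=> f; exact: Cinf_smooth (- vact X f). Qed.
Definition vfieldN X := MkVfield (vfieldN_smooth X).

Lemma vfieldD_smooth (X Y : vfield) : smooth_field (fun p => X p + Y p).
Proof. by move=> f; exact: Cinf_smooth (vact X f + vact Y f). Qed.
Definition vfieldD X Y := MkVfield (vfieldD_smooth X Y).

Lemma vfieldZ_smooth (h : Cinf M) (X : vfield) :
  smooth_field (fun p => h p *: X p).
Proof. by move=> f; exact: Cinf_smooth (h * vact X f). Qed.
Definition vfieldZ h X := MkVfield (vfieldZ_smooth h X).

Fact vfieldDA : associative vfieldD.
Proof. by move=> X Y Z; apply: vfield_eq => p f; rewrite /= addrA. Qed.
Fact vfieldDC : commutative vfieldD.
Proof. by move=> X Y; apply: vfield_eq => p f; rewrite /= addrC. Qed.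
Fact vfieldD0 : left_id vfield0 vfieldD.
Proof. by move=> X; apply: vfield_eq => p f; rewrite /= add0r. Qed.
Fact vfieldDN : left_inverse vfield0 vfieldN vfieldD.
Proof. by move=> X; apply: vfield_eq => p f; rewrite /= addNr. Qed.

HB.instance Definition _ :=
  GRing.isZmodule.Build vfield vfieldDA vfieldDC vfieldD0 vfieldDN.

Fact vfieldZA (g h : Cinf M) X : vfieldZ g (vfieldZ h X) = vfieldZ (g * h) X.
Proof. by apply: vfield_eq => p f; rewrite /= scalerA. Qed.
Fact vfieldZ1 : left_id 1 vfieldZ.
Proof. by move=> X; apply: vfield_eq => p f; rewrite /= scale1r. Qed.
Fact vfieldZDr : right_distributive vfieldZ +%R.
Proof. by move=> h X Y; apply: vfield_eq => p f; rewrite /= scalerDr. Qed.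
Fact vfieldZDl X : {morph vfieldZ^~ X : g h / g + h}.
Proof. by move=> g h; apply: vfield_eq => p f; rewrite /= scalerDl. Qed.

HB.instance Definition _ := GRing.Zmodule_isLmodule.Build (Cinf M) vfield
  vfieldZA vfieldZ1 vfieldZDr vfieldZDl.

Definition bracket_at (X Y : vfield) (p : M) (f : Cinf M) : R^o :=
  X p (vact Y f) - Y p (vact X f).

Lemma bracket_derivation X Y p : bracket_at X Y p \in derivation_pred p.
Proof.
have vD (Z : vfield) f g : vact Z (f + g) = vact Z f + vact Z g.
  by apply: Cinf_eq => q; case: (tangentP (Z q)) => + _ _; apply.
have vZ (Z : vfield) (c : R) f : vact Z (c *: f) = c *: vact Z f.
  by apply: Cinf_eq => q; case: (tangentP (Z q)) => _ + _; apply.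
have vM (Z : vfield) f g : vact Z (f * g) = f * vact Z g + g * vact Z f.
  by apply: Cinf_eq => q; case: (tangentP (Z q)) => _ _; apply.
have [XD XZ XM] := tangentP (X p); have [YD YZ YM] := tangentP (Y p).
apply/asboolP; split=> [f g|c f|f g]; rewrite /bracket_at.
- by rewrite !vD XD YD opprD addrACA.
- by rewrite !vZ XZ YZ mulrBr.
- rewrite !vM XD YD !XM !YM /=.
  have arith (a b c d e h r s t u : R) :
    a * b + c * d + (e * h + r * s) - (a * t + s * r + (e * u + d * c)) =
    a * (b - t) + e * (h - u) by ring.
  exact: arith.
Qed.

Lemma bracket_smooth X Y : smooth_field (fun p => MkTangent (bracket_derivation X Y p)).
Proof.
by move=> f; exact: Cinf_smooth (vact X (vact Y f) - vact Y (vact X f)).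
Qed.

Definition bracket (X Y : vfield) : vfield := MkVfield (bracket_smooth X Y).

Record one_form := MkOneForm {
  one_form_at : forall p : M, {scalar tangent p};
  one_form_smooth :
    forall X : vfield, is_smooth (fun p => one_form_at p (X p))
}.

Definition pairing (theta : one_form) (X : vfield) : Cinf M :=
  MkCinf (asboolT (one_form_smooth theta X)).

End TangentSpace.

(** R-homogeneity in the second argument is [cov_leibniz] for constant f. *)

Record connection (R : realType) (n : nat) (M : manifold R n) := Connection {
  cov :> vfield M -> vfield M -> vfield M;
  covDl : forall X X' Y, cov (X + X') Y = cov X Y + cov X' Y;
  covZl : forall (f : Cinf M) X Y, cov (f *: X) Y = f *: cov X Y;
  covDr : forall X Y Y', cov X (Y + Y') = cov X Y + cov X Y';
  cov_leibniz : forall X (f : Cinf M) Y,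
    cov X (f *: Y) = vact X f *: Y + f *: cov X Y
}.

Section Tensors.
Context (R : realType) (n : nat) (M : manifold R n) (nabla : connection M).
Implicit Types (X Y Z : vfield M) (theta : one_form M).

Definition cyclic (V : zmodType) (F : vfield M -> vfield M -> vfield M -> V)
    X Y Z : V :=
  F X Y Z + F Y Z X + F Z X Y.

Definition torsion X Y : vfield M := nabla X Y - nabla Y X - bracket X Y.

Definition curvature X Y Z : vfield M :=
  nabla X (nabla Y Z) - nabla Y (nabla X Z) - nabla (bracket X Y) Z.

Definition cov_form theta X Y : Cinf M :=
  vact X (pairing theta Y) - pairing theta (nabla X Y).

Definition cov_tensor (S : vfield M -> vfield M -> vfield M) X Y Z : vfield M :=
  nabla X (S Y Z) - S (nabla X Y) Z - S Y (nabla X Z).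

Definition torsion_form theta X Y : Cinf M := pairing theta (torsion X Y).

Definition Xi_form theta X Y : Cinf M :=
  cov_form theta Y X - cov_form theta X Y.

Definition curvature_form theta : vfield M -> vfield M -> vfield M -> Cinf M :=
  cyclic (fun X Y Z => pairing theta (curvature X Y Z)).

Definition cov_wedge_torsion theta :
    vfield M -> vfield M -> vfield M -> Cinf M :=
  cyclic (fun X Y Z => cov_form theta X (torsion Y Z)).

(** A 2-form is represented by its values on pairs of vector fields. *)
Definition ext_d (beta : vfield M -> vfield M -> Cinf M) :
    vfield M -> vfield M -> vfield M -> Cinf M :=
  cyclic (fun X Y Z => vact X (beta Y Z) - beta (bracket X Y) Z).

End Tensors.

(* Main.v *)
(** Both statements hold for every connection.  Statement (ii) is the first
    Bianchi identity: by the Jacobi identity, the cyclic sum of R(X,Y)Z equals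
    that of nabla_X (T(Y,Z)) - T([X,Y],Z), and substituting
    [X,Y] = nabla_X Y - nabla_Y X - T(X,Y) produces the two torsion terms.
    For (i), T_theta - Xi_theta = d theta, so d T_theta = d Xi_theta, and the
    Leibniz rule for theta(T(Y,Z)) turns d T_theta into (nabla theta /\ T) plus
    theta applied to the same cyclic sum. *)

Require Import Defs.
From mathcomp Require Import all_boot all_order all_algebra.
From mathcomp Require Import ring.
From mathcomp Require Import all_classical all_reals all_analysis.

Import GRing.Theory.

Local Open Scope classical_set_scope.
Local Open Scope ring_scope.

Section VectorFields.
Context (R : realType) (n : nat) (M : manifold R n).
Implicit Types (X Y Z : vfield M) (f g : Cinf M) (theta : one_form M).

Lemma tangentD (p : M) (v : tangent p) f g : v (f + g) = v f + v g.
Proof. by case: (tangentP v) => + _ _; apply. Qed.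

Lemma tangentN (p : M) (v : tangent p) f : v (- f) = - v f.
Proof.
by case: (tangentP v) => _ vZ _; rewrite -scaleN1r vZ mulN1r.
Qed.

Lemma vactD X f g : vact X (f + g) = vact X f + vact X g.
Proof. by apply: Cinf_eq => p; exact: tangentD. Qed.

Lemma vactN X f : vact X (- f) = - vact X f.
Proof. by apply: Cinf_eq => p; exact: tangentN. Qed.

Lemma vact_vfieldD X Y f : vact (X + Y) f = vact X f + vact Y f.
Proof. exact: Cinf_eq. Qed.

Lemma vact_vfieldN X f : vact (- X) f = - vact X f.
Proof. exact: Cinf_eq. Qed.

Lemma vact_vfield0 f : vact 0 f = 0.
Proof. exact: Cinf_eq. Qed.

Lemma vact_bracket X Y f :
  vact (bracket X Y) f = vact X (vact Y f) - vact Y (vact X f).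
Proof. exact: Cinf_eq. Qed.

(** Testing on functions moves an identity between vector fields into the commutative ring [Cinf M],
    where [ring] applies. *)
Lemma vfieldP X Y : (forall f, vact X f = vact Y f) -> X = Y.
Proof.
by move=> XY; apply: vfield_eq => p f; exact: (congr1 (fun h : Cinf M => h p) (XY f)).
Qed.

Definition vactE := (vact_bracket, vact_vfield0, vact_vfieldD, vact_vfieldN, vactD, vactN).

Lemma bracketBl X Y Z : bracket (X - Y) Z = bracket X Z - bracket Y Z.
Proof. by apply: vfieldP => f; rewrite !vactE; ring. Qed.

(** Each bracket acts as a commutator of operators, so the twelve triple composites cancel in
    pairs. *)
Lemma jacobi X Y Z : cyclic (fun A B C => bracket (bracket A B) C) X Y Z = 0.
Proof.
by rewrite /cyclic; apply: vfieldP => f; rewrite !vactE; ring.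
Qed.

Lemma pairingD theta X Y :
  pairing theta (X + Y) = pairing theta X + pairing theta Y.
Proof. by apply: Cinf_eq => p; exact: raddfD. Qed.

Lemma pairingN theta X : pairing theta (- X) = - pairing theta X.
Proof. by apply: Cinf_eq => p; exact: raddfN. Qed.

Lemma pairing_cyclic theta (F : vfield M -> vfield M -> vfield M -> vfield M)
    X Y Z :
  pairing theta (cyclic F X Y Z) =
  cyclic (fun A B C => pairing theta (F A B C)) X Y Z.
Proof. by rewrite /cyclic !pairingD. Qed.

End VectorFields.

Section TorsionAndCurvature.
Context (R : realType) (n : nat) (M : manifold R n) (nabla : connection M).
Implicit Types (X Y Z : vfield M) (theta : one_form M).

Lemma covNl X Y : nabla (- X) Y = - nabla X Y.
Proof. by rewrite -scaleN1r covZl scaleN1r. Qed.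

Lemma covNr X Y : nabla X (- Y) = - nabla X Y.
Proof.
apply: (addrI (nabla X Y)); rewrite -covDr !subrr.
by apply: (addrI (nabla X 0)); rewrite -covDr !addr0.
Qed.

Definition covE := (covDl, covDr, covNl, covNr).

Lemma torsionBl X Y Z :
  torsion nabla (X - Y) Z = torsion nabla X Z - torsion nabla Y Z.
Proof.
rewrite /torsion bracketBl !covE; apply: vfieldP => f.
by rewrite !(vact_vfieldD, vact_vfieldN); ring.
Qed.

Lemma torsion_antisym X Y : torsion nabla X Y = - torsion nabla Y X.
Proof. by apply: vfieldP => f; rewrite /torsion !vactE; ring. Qed.

Lemma cyclic_curvature X Y Z :
  cyclic (curvature nabla) X Y Z =
  cyclic (fun A B C =>
    nabla A (torsion nabla B C) - torsion nabla (bracket A B) C) X Y Z.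
Proof.
(* Unfolding the torsions leaves the double brackets [bracket (bracket A B) C]; the zero added on
   the left is their cyclic sum. The terms [nabla A (bracket B C)] cancel cyclically. *)
rewrite -[LHS]addr0 -(jacobi _ _ _ X Y Z) /cyclic /curvature /torsion !covE.
by apply: vfieldP => f; rewrite !(vact_vfieldD, vact_vfieldN); ring.
Qed.

(* Substitute [A,B] = nabla_A B - nabla_B A - T(A,B) in the torsion term. *)
Lemma cyclic_cov_torsion X Y Z :
  cyclic (fun A B C =>
    nabla A (torsion nabla B C) - torsion nabla (bracket A B) C) X Y Z =
  cyclic (cov_tensor nabla (torsion nabla)) X Y Z +
  cyclic (fun A B C => torsion nabla (torsion nabla A B) C) X Y Z.
Proof.
have bracketE A B : bracket A B = nabla A B - nabla B A - torsion nabla A B.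
  by rewrite /torsion opprB addrC subrK.
rewrite /cyclic !bracketE !torsionBl /cov_tensor.
(* Antisymmetry puts the covariant derivative in the first slot, as in the terms coming from the
   brackets, so that [ring] sees equal atoms. *)
rewrite [torsion nabla Y (nabla X Z)]torsion_antisym.
rewrite [torsion nabla Z (nabla Y X)]torsion_antisym.
rewrite [torsion nabla X (nabla Z Y)]torsion_antisym.
by apply: vfieldP => f; rewrite !(vact_vfieldD, vact_vfieldN); ring.
Qed.

Lemma first_bianchi X Y Z :
  cyclic (curvature nabla) X Y Z =
  cyclic (cov_tensor nabla (torsion nabla)) X Y Z +
  cyclic (fun A B C => torsion nabla (torsion nabla A B) C) X Y Z.
Proof. by rewrite cyclic_curvature cyclic_cov_torsion. Qed.

(** By the definition of [cov_form], the two terms containing [nabla A (torsion nabla B C)] add up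
    to the derivative of [pairing theta (torsion nabla B C)] along [A]. *)
Lemma ext_d_torsion_form theta X Y Z :
  ext_d (torsion_form nabla theta) X Y Z =
  pairing theta (cyclic (fun A B C =>
    nabla A (torsion nabla B C) - torsion nabla (bracket A B) C) X Y Z) +
  cov_wedge_torsion nabla theta X Y Z.
Proof.
rewrite pairing_cyclic /ext_d /cov_wedge_torsion /cyclic /torsion_form /cov_form.
by rewrite !(pairingD, pairingN); ring.
Qed.

(* The difference T_theta - Xi_theta is the 2-form d theta. *)
Lemma ext_d_torsion_form_Xi theta X Y Z :
  ext_d (torsion_form nabla theta) X Y Z = ext_d (Xi_form nabla theta) X Y Z.
Proof.
have torsionE A B : torsion_form nabla theta A B = Xi_form nabla theta A B +
    (vact A (pairing theta B) - vact B (pairing theta A) -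
     pairing theta (bracket A B)).
  rewrite /torsion_form /Xi_form /cov_form /torsion !(pairingD, pairingN).
  by ring.
(* It remains to see that d(d theta) = 0: the second derivatives cancel by [vact_bracket], the
   double brackets by the Jacobi identity paired with [theta]. *)
have := congr1 (pairing theta) (jacobi _ _ _ X Y Z).
rewrite pairing_cyclic (_ : pairing theta 0 = 0); last first.
  by rewrite -(subrr X) pairingD pairingN subrr.
rewrite /cyclic => J.
rewrite /ext_d /cyclic !torsionE -[RHS]addr0 -[in RHS]J !vactE.
by ring.
Qed.

End TorsionAndCurvature.

Theorem proposition3p1 (R : realType) (n : nat) (M : manifold R n)
    (connM : connected [set: M]) (nabla : connection M) :
  (forall (theta : one_form M) (X Y Z : vfield M),
      ext_d (torsion_form nabla theta) X Y Z =
        ext_d (Xi_form nabla theta) X Y Z /\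
      ext_d (Xi_form nabla theta) X Y Z =
        curvature_form nabla theta X Y Z + cov_wedge_torsion nabla theta X Y Z)
  <->
  (forall X Y Z : vfield M,
      cyclic (curvature nabla) X Y Z =
        cyclic (cov_tensor nabla (torsion nabla)) X Y Z +
        cyclic (fun A B C => torsion nabla (torsion nabla A B) C) X Y Z).
Proof.
split=> [_ X Y Z|bianchi theta X Y Z]; first exact: first_bianchi.
split; first exact: ext_d_torsion_form_Xi.
(* The field paired with [theta] becomes the right side of (ii), which [bianchi] trades for the
   cyclic sum of curvatures. *)
rewrite -ext_d_torsion_form_Xi ext_d_torsion_form cyclic_cov_torsion -bianchi.
by rewrite pairing_cyclic.
Qed.
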